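(* For each integer $k \ge 2$, there exists a numerical semigroup $S$ such that $\Delta_0(S) = \{1, 2, \ldots, k-1\}$.
   Context: A numerical semigroup is a cofinite, additively closed subset $S \subseteq \mathbb{Z}_{\ge 0}$ containing $0$. Let $S$ have minimal generators $a_1,\ldots,a_n$. For $x \in S$, $\mathsf Z(x) = \{z \in \mathbb{Z}_{\ge 0}^n : x = z_1a_1 + \cdots + z_na_n\}$; $\ell_0(z) = |\{i : z_i > 0\}|$; $\mathcal L_0(x) = \{\ell_0(z) : z \in \mathsf Z(x)\} = \{c_1 < \cdots < c_r\}$; $\Delta_0(x) = \{c_i - c_{i-1} : i = 2,\ldots,r\}$; $\Delta_0(S) = \bigcup_{x \in S}\Delta_0(x)$. *)

(* Defs.v *)
From mathcomp Require Import all_boot.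
From mathcomp Require Import boolp classical_sets functions cardinality.

Set Implicit Arguments.
Unset Strict Implicit.
Unset Printing Implicit Defensive.

Local Open Scope classical_set_scope.

Record numerical_semigroup (S : set nat) : Prop := NumericalSemigroup {
  numerical_semigroup0 : S 0;
  numerical_semigroupD : forall x y, S x -> S y -> S (x + y);
  numerical_semigroup_cofinite : finite_set (~` S)
}.

Definition factorizations (a : seq nat) (x : nat) :
    set {ffun 'I_(size a) -> nat} :=
  [set z : {ffun 'I_(size a) -> nat} |
     x = \sum_(i < size a) z i * nth 0 a i].
Arguments factorizations : clear implicits.

Definition generates (a : seq nat) (S : set nat) : Prop :=
  S = [set x | factorizations a x !=set0].

(* Minimality over sublists also forbids repetitions in [a].  The order of the
   list is arbitrary; permuting it does not affect the length sets below. *)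
Definition minimal_generators (a : seq nat) (S : set nat) : Prop :=
  generates a S /\ (forall b : seq nat, subseq b a -> generates b S -> b = a).

Definition ell0 (n : nat) (z : {ffun 'I_n -> nat}) : nat :=
  #|[pred i : 'I_n | 0 < z i]|.

Definition lengths0 (a : seq nat) (x : nat) : set nat :=
  @ell0 (size a) @` factorizations a x.

Definition delta0_elt (a : seq nat) (x : nat) : set nat :=
  [set d | exists c : seq nat,
     [/\ sorted ltn c,
         lengths0 a x = [set` c]
       & exists2 i, i.+1 < size c & d = nth 0 c i.+1 - nth 0 c i]].

(* Here [a] is meant to list the minimal generators of [S]. *)
Definition delta0 (S : set nat) (a : seq nat) : set nat :=
  \bigcup_(x in S) delta0_elt a x.

(* Main.v *)
Require Import Defs.
From mathcomp Require Import all_boot.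
From mathcomp Require Import boolp classical_sets functions cardinality.
From mathcomp Require Import zify.

(** Write n = k - 1. A semigroup with n + 1 minimal generators has all its
    l0-lengths between 0 and n + 1, and 0 occurs only for the element 0, whose
    factorization is unique. Hence every gap is at most n
    ([delta0_elt_bounds]), and it suffices to find n + 1 minimal generators
    for which every gap 1, ..., n does occur.

    The idea is to have one short relation, which trades a multiple of the
    first generator for a sum involving all the others. With A = [modulus n],
    B = [base n] and generators A and a_i = 3 A + B ^ i for i < n, where
    A = 2 (1 + B + ... + B ^ (n - 1)), the relation is
      (6 n + 1) A = 2 (a_0 + ... + a_(n-1)).
    The element x_j = (6 n + 2) A + a_0 + ... + a_(j-1), for j < n, has a
    factorization of length j + 1 as written, and applying the relation once
    yields one of length n + 1, since a single copy of A remains. There is no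
    third factorization ([lincomb_witness_inj]): the term 3 A in each a_i
    limits the total number of a_i in use, so the coefficients are digits in
    base B; modulo A these digits must represent 1 + ... + B ^ (j - 1), and,
    all digits being small, this leaves only the multiples of the relation.
    Thus the length set of x_j is {j + 1, n + 1}, with gap n - j, and j runs
    over 0, ..., n - 1.

    The same reading of coefficients as digits shows that the generators are
    minimal ([gens_indep]); the complement is finite because A and
    a_0 = 3 A + 1 are coprime ([numerical_semigroup_span]). *)

Local Open Scope classical_set_scope.

(** * Factorizations as coefficient functions on the natural numbers *)

(** Coefficients indexed by all of nat avoid dependent index types when the
    length of the list is known only up to a propositional equality. *)
Definition lincomb (a : seq nat) (w : nat -> nat) : nat :=
  \sum_(i < size a) w i * nth 0 a i.

Lemma lincomb_cons (x : nat) (a : seq nat) (w : nat -> nat) :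
  lincomb (x :: a) w = w 0 * x + lincomb a (fun i => w i.+1).
Proof. by rewrite /lincomb big_ord_recl. Qed.

Definition ffun_ext0 (m : nat) (z : {ffun 'I_m -> nat}) (i : nat) : nat :=
  if insub i is Some j then z j else 0.

Lemma ffun_ext0E (m : nat) (z : {ffun 'I_m -> nat}) (i : 'I_m) :
  ffun_ext0 m z i = z i.
Proof. by rewrite /ffun_ext0 valK. Qed.

Lemma ell0_sum (m : nat) (z : {ffun 'I_m -> nat}) :
  ell0 z = \sum_(i < m) (0 < z i).
Proof.
rewrite /ell0 -sum1_card big_mkcond; apply: eq_bigr => i _.
by rewrite inE; case: ltnP.
Qed.

Lemma lengths0P (a : seq nat) (x l : nat) :
  lengths0 a x l <-> exists2 w, x = lincomb a w & l = \sum_(i < size a) (0 < w i).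
Proof.
split=> [[z zx <-]|[w xE ->]].
  exists (ffun_ext0 _ z).
    by rewrite [LHS]zx; apply: eq_bigr => i _; rewrite ffun_ext0E.
  by rewrite ell0_sum; apply: eq_bigr => i _; rewrite ffun_ext0E.
exists [ffun i : 'I_(size a) => w i].
  by rewrite /factorizations /= xE; apply: eq_bigr => i _; rewrite ffunE.
by rewrite ell0_sum; apply: eq_bigr => i _; rewrite ffunE.
Qed.

(** * Semigroups spanned by a list *)

Definition span (a : seq nat) : set nat := [set x | factorizations a x !=set0].

Lemma spanP (a : seq nat) (x : nat) : span a x <-> exists w, x = lincomb a w.
Proof.
split=> [[z zx]|[w xE]].
  have /lengths0P[w xE _] : lengths0 a x (ell0 z) by exists z.
  by exists w.
have [z zx _] : lengths0 a x (\sum_(i < size a) (0 < w i)).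
  by apply/lengths0P; exists w.
by exists z.
Qed.

Lemma span0 (a : seq nat) : span a 0.
Proof. by apply/spanP; exists (fun=> 0); rewrite /lincomb big1. Qed.

Lemma spanD (a : seq nat) (x y : nat) : span a x -> span a y -> span a (x + y).
Proof.
move=> /spanP[v ->] /spanP[w ->]; apply/spanP; exists (fun i => v i + w i).
by rewrite /lincomb -big_split; apply: eq_bigr => i _; rewrite mulnDl.
Qed.

Lemma span_nth (a : seq nat) (i : nat) : i < size a -> span a (nth 0 a i).
Proof.
move=> ia; apply/spanP; exists (fun j => j == i : nat).
rewrite /lincomb (bigD1 (Ordinal ia)) //= eqxx mul1n big1 ?addn0 // => j.
by rewrite -val_eqE => /negbTE ->.
Qed.

(** The elements m and c m + 1 alone already reach everything from
    m (c m + 1) on: r copies of c m + 1 produce the residue r < m, and the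
    rest is a multiple of m. *)
Lemma numerical_semigroup_span (a : seq nat) (m c : nat) :
  0 < m -> span a m -> span a (c * m + 1) -> numerical_semigroup (span a).
Proof.
move=> m0 Sm Sc.
have SM x q : span a x -> span a (q * x).
  by move=> Sx; elim: q => [|q IH]; [exact: span0 | rewrite mulSn; apply: spanD].
split; [exact: span0 | exact: spanD |].
apply: (sub_finite_set _ (finite_II (m * (c * m + 1)))) => x /= nSx.
rewrite ltnNge; apply/negP => lex; apply: nSx.
have -> : x = x %% m * (c * m + 1) + (x %/ m - x %% m * c) * m.
  have xE := divn_eq x m; have ltr := ltn_pmod x m0.
  have : x %% m * c <= x %/ m.
    rewrite leq_divRL //; apply: leq_trans lex.
    by move: ltr; move: (x %% m) => r ltr; nia.
  by move: xE; move: (x %% m) (x %/ m) => r q; nia.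
by apply: spanD; apply: SM.
Qed.

Lemma lincomb_mask (m : seq bool) (a : seq nat) (v : nat -> nat) :
  size m = size a ->
  exists2 w, lincomb (mask m a) v = lincomb a w &
    forall i, ~~ nth false m i -> w i = 0.
Proof.
elim: m a v => [|b m IH] [|x a] // v.
  by exists (fun=> 0) => //; rewrite /lincomb !big_ord0.
move=> [sz]; case: b.
  have [w wE w0] := IH a (fun i => v i.+1) sz.
  exists (fun i => if i is i'.+1 then w i' else v 0).
    by rewrite /= !lincomb_cons wE.
  by case=> [|i] //=; apply: w0.
have [w wE w0] := IH a v sz.
exists (fun i => if i is i'.+1 then w i' else 0).
  by rewrite /= lincomb_cons wE.
by case=> [|i] //=; apply: w0.
Qed.

(** If a proper sublist dropped position i and still generated the span, it
    would express the i-th entry with coefficient 0 at i. The hypothesis also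
    excludes repeated entries, as it must. *)
Lemma minimal_generators_span (a : seq nat) :
  (forall w i, i < size a -> lincomb a w = nth 0 a i -> 0 < w i) ->
  minimal_generators a (span a).
Proof.
move=> indep; split=> // b /subseqP[m sz ->] gen.
suff /all_pred1P -> : all (pred1 true) m by rewrite mask_true ?sz.
apply/(all_nthP false) => i; rewrite sz => ia; apply/eqP/negP => /negP mi.
have := span_nth a i ia; rewrite gen => /spanP[v].
have [w -> w0] := lincomb_mask m a v sz => /esym /(indep _ _ ia).
by rewrite w0.
Qed.

(** * The generators *)

Lemma digits_inj (B n : nat) (f g : nat -> nat) :
  (forall i, i < n -> f i < B) -> (forall i, i < n -> g i < B) ->
  \sum_(i < n) f i * B ^ i = \sum_(i < n) g i * B ^ i ->
  forall i, i < n -> f i = g i.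
Proof.
elim: n f g => [|n IH] f g fB gB //.
have shift (h : nat -> nat) : \sum_(i < n.+1) h i * B ^ i =
    (\sum_(i < n) h i.+1 * B ^ i) * B + h 0.
  rewrite big_ord_recl muln1 addnC big_distrl /=; congr (_ + _).
  by apply: eq_bigr => i _; rewrite expnSr mulnA.
have B0 : 0 < B by apply: leq_ltn_trans (fB 0 _).
rewrite !shift => E.
have E0 : f 0 = g 0.
  by move/(congr1 (modn^~ B)): E; rewrite !modnMDl !modn_small ?fB ?gB.
move: E; rewrite E0 => /addIn /eqP; rewrite eqn_pmul2r // => /eqP E [|i] // ltin.
apply: (IH (fun i => f i.+1) (fun i => g i.+1)) => // j ltjn.
  exact: fB.
exact: gB.
Qed.

(** * The upper bound on gaps *)

Lemma delta0_elt_bounds (a : seq nat) (x d : nat) :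
  (forall i, i < size a -> 0 < nth 0 a i) ->
  delta0_elt a x d -> 1 <= d <= size a - 1.
Proof.
move=> pos [c [csort cE [i ic ->]]].
have cmem l : l \in c -> lengths0 a x l by rewrite cE.
have lt_c : nth 0 c i < nth 0 c i.+1.
  by rewrite (sorted_ltn_nth ltn_trans) // inE // ltnW.
have /cmem/lengths0P[w xw wE] := mem_nth 0 ic.
have /cmem/lengths0P[v xv vE] := mem_nth 0 (ltnW ic).
have le_size : nth 0 c i.+1 <= size a.
  rewrite wE -[leqRHS]card_ord -sum1_card.
  by apply: leq_sum => j _; case: (0 < w j).
suff : 0 < nth 0 c i by lia.
rewrite lt0n; apply/eqP => ci0.
(* length 0 forces x = 0, whose only factorization is trivial *)
have x0 : x = 0.
  rewrite xv /lincomb big1 // => j _.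
  move/eqP: vE; rewrite ci0 eq_sym sum_nat_eq0 => /forallP/(_ j)/=.
  by case: (v j).
move/eqP: xw; rewrite x0 eq_sym /lincomb sum_nat_eq0 => /forallP /= w0.
suff w00 : nth 0 c i.+1 = 0 by rewrite w00 in lt_c.
rewrite wE big1 // => j _; have := w0 j; rewrite muln_eq0.
by have := pos j (ltn_ord j); case: (w j) => [|?] //=; case: (nth 0 a j).
Qed.

(** In [lincomb_witness_inj] the digits to be compared are at most 2 q + 1 with
    q <= 6 n + 2 + 3 j <= 9 n - 1, hence below 18 n. *)
Definition base (n : nat) : nat := 18 * n.
Definition modulus (n : nat) : nat := \sum_(i < n) 2 * base n ^ i.
Definition gens (n : nat) : seq nat :=
  modulus n :: mkseq (fun i => 3 * modulus n + base n ^ i) n.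

Lemma size_gens (n : nat) : size (gens n) = n.+1.
Proof. by rewrite /= size_mkseq. Qed.

Lemma nth_gens (n i : nat) :
  i < n -> nth 0 (gens n) i.+1 = 3 * modulus n + base n ^ i.
Proof. exact: nth_mkseq. Qed.

Lemma lincomb_gens (n : nat) (w : nat -> nat) :
  lincomb (gens n) w =
  (w 0 + 3 * \sum_(i < n) w i.+1) * modulus n +
  \sum_(i < n) w i.+1 * base n ^ i.
Proof.
rewrite lincomb_cons mulnDl -addnA; congr (_ + _).
rewrite /lincomb size_mkseq; move: (modulus n) => A.
rewrite mulnAC big_distrr -big_split /=.
by apply: eq_bigr => i _; rewrite nth_mkseq // mulnDr [w _ * (3 * _)]mulnC.
Qed.

Lemma partial_repunit_lt (n j : nat) : 0 < n ->
  \sum_(i < n) (i < j) * base n ^ i < modulus n.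
Proof.
move=> n0; rewrite /modulus -big_distrr /=.
have B0 : 0 < base n by rewrite muln_gt0.
have : 0 < \sum_(i < n) base n ^ i by rewrite (bigD1 (Ordinal n0)) //= expn0.
have : \sum_(i < n) (i < j) * base n ^ i <= \sum_(i < n) base n ^ i.
  by apply: leq_sum => i _; case: (i < j); rewrite ?mul1n.
move=> leES S0; apply: leq_ltn_trans leES _; exact: ltn_Pmull.
Qed.

Lemma power_lt_modulus (n i : nat) : i < n -> base n ^ i < modulus n.
Proof.
move=> lt_in; rewrite /modulus (bigD1 (Ordinal lt_in)) //=.
have : 0 < base n ^ i by rewrite expn_gt0 muln_gt0 (leq_ltn_trans _ lt_in).
lia.
Qed.

Lemma le_term_sum (n : nat) (v : nat -> nat) (i : nat) :
  i < n -> v i <= \sum_(i < n) v i.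
Proof. by move=> lt_in; rewrite (bigD1 (Ordinal lt_in)) //= leq_addr. Qed.

(** For size reasons A is a combination of generators only through itself, and
    3 A + B ^ i involves at most one of the large generators: exactly one, as
    B ^ i is not divisible by A. Comparing base-B digits identifies it. *)
Lemma gens_indep (n : nat) (w : nat -> nat) (i : nat) : 0 < n ->
  i < size (gens n) -> lincomb (gens n) w = nth 0 (gens n) i -> 0 < w i.
Proof.
move=> n0; rewrite size_gens lincomb_gens.
set A := modulus n; set t := \sum_(i < n) w i.+1; set R := \sum_(i < n) _.
have A0 : 0 < A by apply: leq_ltn_trans (power_lt_modulus n 0 n0).
have R0 : t = 0 -> R = 0.
  move/eqP; rewrite sum_nat_eq0 => /forallP/= w0.
  by apply: big1 => j _; rewrite (eqP (w0 j)).
case: i => [_ /= E|i].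
  rewrite lt0n; apply/eqP => w0; move: E; rewrite w0 -/A => E.
  have t0 : t = 0 by nia.
  by move: E; rewrite t0 (R0 t0); lia.
rewrite ltnS => lt_in; rewrite nth_gens // -/A => E.
have ltA : base n ^ i < A by apply: power_lt_modulus.
have t1 : t = 1.
  have : t <= 1 by nia.
  case: (posnP t) => [t0|]; last lia.
  (* otherwise A would divide B ^ i, which lies strictly between 0 and A *)
  move: E; rewrite t0 (R0 t0).
  have : 0 < base n ^ i by rewrite expn_gt0 muln_gt0 n0.
  by case: (leqP (w 0) 3); nia.
have RE : R = \sum_(j < n) (j == i :> nat) * base n ^ j.
  rewrite (bigD1 (Ordinal lt_in)) //= eqxx mul1n big1 ?addn0; last first.
    by move=> j; rewrite -val_eqE => /negbTE ->.
  have w00 : w 0 = 0 by rewrite t1 in E; case: (w 0) E => // u; nia.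
  by move: E; rewrite w00 t1 add0n muln1 => /addnI.
have B2 : 1 < base n by rewrite /base; lia.
rewrite (digits_inj _ _ (fun j => w j.+1) (fun j => j == i) _ _ RE) ?eqxx //.
  move=> j ltjn; apply: leq_ltn_trans B2.
  by rewrite -t1; apply: (le_term_sum n (fun j => w j.+1)).
by move=> j _; case: (j == i); lia.
Qed.

(** * The elements with two lengths *)

(** The coefficients of x_j after q applications of the relation
    (6 n + 1) A = 2 (a_0 + ... + a_(n-1)); position 0 belongs to A and
    position i + 1 to a_i. Only q = 0 and q = 1 leave a nonnegative
    coefficient for A. *)
Definition witness (n j q i : nat) : nat :=
  if i is i'.+1 then 2 * q + (i' < j) else (6 * n + 2) - q * (6 * n + 1).

Lemma sum_ltn_ord (n j : nat) : j <= n -> \sum_(i < n) (i < j) = j.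
Proof.
move=> le_jn; rewrite -[RHS]card_ord -sum1_card.
rewrite (big_ord_widen n (fun=> 1) le_jn) [RHS]big_mkcond.
by apply: eq_bigr => i _; case: (i < j).
Qed.

Lemma sum_witness (n j q : nat) : j <= n ->
  \sum_(i < n) witness n j q i.+1 = 2 * q * n + j.
Proof.
by move=> le_jn; rewrite big_split /= sum_nat_const card_ord mulnC sum_ltn_ord.
Qed.

Lemma digits_witness (n j q : nat) :
  \sum_(i < n) witness n j q i.+1 * base n ^ i =
  q * modulus n + \sum_(i < n) (i < j) * base n ^ i.
Proof.
rewrite /modulus big_distrr -big_split /=.
by apply: eq_bigr => i _; rewrite mulnDl mulnCA mulnA.
Qed.

Lemma lincomb_witness (n j q : nat) : j <= n -> q <= 1 ->
  lincomb (gens n) (witness n j q) = lincomb (gens n) (witness n j 0).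
Proof.
move=> le_jn q1; rewrite !lincomb_gens !sum_witness // !digits_witness /=.
by case: q q1 => [|[]] // _; nia.
Qed.

Lemma eq_quotient_remainder (A p P R E : nat) : E < A ->
  p * A + R = P * A + E -> exists2 q, R = q * A + E & p + q = P.
Proof.
move=> ltEA eqn.
have lepP : p <= P.
  rewrite leqNgt; apply/negP => ltPp.
  have : P.+1 * A <= p * A by rewrite leq_mul2r ltPp orbT.
  by rewrite mulSn; lia.
exists (P - p); last by rewrite subnKC.
by apply: (@addnI (p * A)); rewrite eqn addnA -mulnDl subnKC.
Qed.

(** Let t be the number of generators a_i used, with multiplicity. Splitting
    off the part R = q A + E carried by the powers of B, where E < A is the
    part coming from x_j, comparison of the multiples of A bounds both t and
    q. So the coefficients and the numbers 2 q + (i < j) are all valid base-B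
    digits of R and must coincide; then t = 2 q n + j, and the coefficient of
    A becomes (6 n + 2) - q (6 n + 1), which forces q <= 1. *)
Lemma lincomb_witness_inj (n j : nat) (w : nat -> nat) : 0 < n -> j < n ->
  lincomb (gens n) w = lincomb (gens n) (witness n j 0) ->
  exists2 q, q <= 1 & forall i, i <= n -> w i = witness n j q i.
Proof.
move=> n0 lt_jn; rewrite !lincomb_gens sum_witness ?(ltnW lt_jn) //.
rewrite digits_witness.
have := partial_repunit_lt n j n0.
set A := modulus n; set E := \sum_(i < n) (i < j) * _.
set t := \sum_(i < n) w i.+1; set R := \sum_(i < n) _ * _.
rewrite /= muln0 !mul0n subn0 !add0n => ltEA eqn.
have [q RE qE] : exists2 q, R = q * A + E & w 0 + 3 * t + q = 6 * n + 2 + 3 * j.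
  by apply: eq_quotient_remainder ltEA eqn.
have digit i : i < n -> w i.+1 = witness n j q i.+1.
  have {}RE : R = \sum_(l < n) witness n j q l.+1 * base n ^ l.
    by rewrite digits_witness.
  move=> lt_in.
  apply: (digits_inj _ _ (fun i => w i.+1) (fun i => witness n j q i.+1)
    _ _ RE) => // l lt_ln.
    apply: leq_ltn_trans (le_term_sum n (fun i => w i.+1) l lt_ln) _.
    by rewrite -/t /base; lia.
  by rewrite /base /=; case: (l < j); lia.
have tE : t = 2 * q * n + j.
  rewrite -(sum_witness n j q (ltnW lt_jn)).
  by apply: eq_bigr => i _; apply: digit.
have q1 : q <= 1 by move: qE; rewrite tE; clear -n0; nia.
exists q => // -[_|i /digit //].
by move: qE; rewrite tE /=; case: (q) q1 => [|[]] //; lia.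
Qed.

Lemma ell0_witness (n j q : nat) : j <= n -> q <= 1 ->
  \sum_(i < n.+1) (0 < witness n j q i) = if q == 0 then j.+1 else n.+1.
Proof.
move=> le_jn; case: q => [|[]] // _.
  rewrite big_ord_recl /= addn2 -[RHS]add1n; congr (_ + _).
  rewrite -[RHS](sum_ltn_ord n j) //; apply: eq_bigr => i _.
  by rewrite /bump /=; case: (i < j).
rewrite (eq_bigr (fun=> 1)) ?sum_nat_const ?card_ord ?muln1 //.
by case=> -[|i] lti _ //=; lia.
Qed.

Lemma lengths0_witness (n j : nat) : 0 < n -> j < n ->
  lengths0 (gens n) (lincomb (gens n) (witness n j 0)) = [set` [:: j.+1; n.+1]].
Proof.
move=> n0 lt_jn; apply/seteqP; split=> l /=.
  case/lengths0P=> w /esym /(lincomb_witness_inj n j w n0 lt_jn)[q q1 wE] ->.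
  rewrite size_gens.
  have -> : \sum_(i < n.+1) (0 < w i) = \sum_(i < n.+1) (0 < witness n j q i).
    by apply: eq_bigr => i _; rewrite wE // -ltnS.
  rewrite ell0_witness ?(ltnW lt_jn) //.
  by case: (q == 0); rewrite !inE eqxx ?orbT.
rewrite !inE => lE; apply/lengths0P.
exists (witness n j (l != j.+1)).
  by rewrite lincomb_witness ?leq_b1 // ltnW.
rewrite size_gens ell0_witness ?leq_b1 ?(ltnW lt_jn) //.
by case/orP: lE => /eqP ->; rewrite ?eqxx //=; case: (n.+1 =P j.+1).
Qed.

Theorem theorem4p4 (k : nat) (hk : 2 <= k) :
  exists (S : set nat) (a : seq nat),
    [/\ numerical_semigroup S,
        minimal_generators a S
      & delta0 S a = [set d | 1 <= d <= k - 1]].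
Proof.
case: k hk => [//|n]; rewrite ltnS => n0.
have A0 : 0 < modulus n by apply: leq_ltn_trans (power_lt_modulus n 0 n0).
exists (span (gens n)), (gens n); split.
- have gen i : i < n.+1 -> span (gens n) (nth 0 (gens n) i).
    by move=> lti; apply: span_nth; rewrite size_gens.
  apply: (numerical_semigroup_span _ (modulus n) 3) => //; first exact: (gen 0).
  by have := gen 1 n0; rewrite nth_gens // expn0.
- by apply: minimal_generators_span => w i; apply: gens_indep.
apply/seteqP; split=> d /=.
  case=> x _ /delta0_elt_bounds; rewrite size_gens; apply=> -[//|i].
  by rewrite ltnS => lti; rewrite nth_gens //; lia.
move=> hd; pose j := n - d; have lt_jn : j < n by rewrite /j; lia.
exists (lincomb (gens n) (witness n j 0)).
  by apply/spanP; exists (witness n j 0).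
exists [:: j.+1; n.+1]; split.
- by rewrite /= andbT ltnS.
- exact: lengths0_witness.
by exists 0 => //=; rewrite /j; lia.
Qed.
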